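(* Let $k \geq 4$ be an integer and let $G$ be a finite simple graph of treewidth $k$ with maximum degree $\Delta(G) \geq 2k-1$. Then $\chi'(G) = \Delta(G)$.
   Context: All graphs are finite and simple. $\Delta(G)$ is the maximum degree of $G$. The chromatic index $\chi'(G)$ is the least number of colours in a proper edge-colouring of $G$ (edges sharing an endvertex receive distinct colours). A tree-decomposition of $G$ consists of a tree $T$ and a collection of bags $B_t \subseteq V(G)$, $t\in V(T)$, such that (i) $V(G)=\bigcup_{t\in V(T)} B_t$; (ii) for each edge $vw\in E(G)$ there is $t\in V(T)$ with $v,w\in B_t$; (iii) if $v\in B_s\cap B_t$ then $v\in B_r$ for every vertex $r$ on the path connecting $s$ and $t$ in $T$. It has width $k$ if each bag has size at most $k+1$. The treewidth of $G$ is the smallest integer $k$ for which there is a width $k$ tree-decomposition of $G$. *)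

(* Defs.v *)
From mathcomp Require Import all_boot.

Set Implicit Arguments.
Unset Strict Implicit.
Unset Printing Implicit Defensive.

Record sgraph := SGraph {
  vertex :> finType;
  adj : rel vertex;
  adj_sym : symmetric adj;
  adj_irrefl : irreflexive adj }.

Definition edges (G : sgraph) : {set {set G}} :=
  [set [set x; y] | x in [set: G], y in adj x].

Definition degree (G : sgraph) (x : G) : nat := #|[set y | adj x y]|.

Definition max_degree (G : sgraph) : nat := \max_(x : G) degree x.

(* Colourings are defined on edges only, so that an edgeless graph has a
   colouring with zero colours. *)
Definition edge (G : sgraph) := {f : {set G} | f \in edges G}.

Definition proper_edge_colouring (G : sgraph) (n : nat)
    (c : {ffun edge G -> 'I_n}) : bool :=
  [forall f : edge G, forall g : edge G,
    (f != g) && ~~ [disjoint val f & val g] ==> (c f != c g)].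

Definition edge_colourable (G : sgraph) (n : nat) : bool :=
  [exists c : {ffun edge G -> 'I_n}, proper_edge_colouring c].

Lemma ex_edge_colourable (G : sgraph) : exists n, edge_colourable G n.
Proof.
exists #|{: edge G}|; apply/existsP; exists [ffun f => enum_rank f].
apply/forallP => f; apply/forallP => g; apply/implyP => /andP[fg _].
by rewrite !ffunE (inj_eq enum_rank_inj).
Qed.

Definition chromatic_index (G : sgraph) : nat := ex_minn (ex_edge_colourable G).

(* A cycle is a duplicate-free cyclic sequence of length at least 3: [x; y]
   with x adjacent to y also satisfies ucycle. *)
Definition is_tree (T : sgraph) : Prop :=
  [/\ 0 < #|T|,
      forall s t : T, connect (@adj T) s t
    & forall p : seq T, 2 < size p -> ~ ucycle (@adj T) p].

Record tree_decomposition (G T : sgraph) (B : T -> {set G}) : Prop := {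
  td_tree : is_tree T;
  td_vertex : forall v : G, exists t : T, v \in B t;
  td_edge : forall v w : G, adj v w -> exists t : T, (v \in B t) && (w \in B t);
  (* s :: p is a simple path of T, from s to t *)
  td_path : forall (v : G) (s t : T) (p : seq T),
    path (@adj T) s p -> uniq (s :: p) -> last s p = t ->
    v \in B s -> v \in B t -> forall r : T, r \in s :: p -> v \in B r }.

Definition has_tree_decomposition (G : sgraph) (k : nat) : Prop :=
  exists (T : sgraph) (B : T -> {set G}),
    tree_decomposition B /\ forall t : T, #|B t| <= k.+1.

(* "G has treewidth k".  As k : nat, the empty graph gets treewidth 0 here
   rather than -1; all other graphs are unaffected. *)
Definition treewidth_is (G : sgraph) (k : nat) : Prop :=
  has_tree_decomposition G k /\
  forall j : nat, has_tree_decomposition G j -> k <= j.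

(* Main.v *)
(* A minimal non-Delta-edge-colourable subgraph e is critical: every e - uv has a
   colouring f, and multi-fans and Kempe chains constrain the colours missing in
   f. A tree-decomposition of width k gives an elimination order in which every
   vertex has at most k later neighbours in the chordal graph h joining vertices
   that share a bag. Call a vertex big if its degree exceeds k.

   Let v be a big vertex all of whose earlier h-neighbours are small, and u an
   earlier neighbour of v. The fan at v started at u forces Delta = 2k-1,
   deg u = k, and exactly k later neighbours of v, all of degree Delta. Kempe
   changes then show that the other neighbours of u have no small neighbour
   besides u; as they are later neighbours of v, u is the only earlier
   neighbour of v and deg v = k+1. A last Kempe argument shows that every later
   neighbour w of v has, besides v, at most one neighbour of degree <= k+1. But
   the first big w violating the condition on v has at least k-1 >= 3 earlier
   neighbours, each of degree <= k+1. *)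
Require Import Defs.
From mathcomp Require Import all_boot perm.
From mathcomp Require Import zify.

Set Implicit Arguments.
Unset Strict Implicit.
Unset Printing Implicit Defensive.

(** * Auxiliary facts on paths *)

Lemma sub_path_tail (T : eqType) (r r' : rel T) x p :
  (forall s t, s \in belast x p -> t \in p -> r s t -> r' s t) -> path r x p -> path r' x p.
Proof.
elim: p x => //= y p IH x H /andP[xy yp]; rewrite H ?inE ?eqxx //=.
by apply: IH yp => s t sp tp; apply: H; rewrite inE (sp, tp) orbT.
Qed.

Lemma path_to_first (T : Type) (r : rel T) (Q : pred T) x p : path r x p -> Q (last x p) ->
  exists q, [/\ path r x q, Q (last x q) & ~~ has Q (belast x q)].
Proof.
elim: p x => [|y p IH] x /=; first by exists [::].
case/andP=> xy /IH H /H[q [yq qQ qN]]; case Qx: (Q x); first by exists [::].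
by exists (y :: q); rewrite /= xy Qx.
Qed.

(** * Partial edge-colourings and their missing colours *)

Section Colouring.
Variables (V C : finType).
Implicit Types (e : rel V) (f : V -> V -> option C) (x y z u v w : V) (a b c : C).

(* f is a partial colouring: non-edges of e are sent to None, so f determines e. *)
Definition colours e f : Prop :=
  [/\ forall x y, f x y = f y x, forall x y, f x y = e x y :> bool
    & forall x y z c, f x y = Some c -> f x z = Some c -> y = z].

Definition colourable e : Prop := exists f, colours e f.

Definition del e u v : rel V :=
  fun x y => e x y && ~~ ((x == u) && (y == v) || (x == v) && (y == u)).

Definition nbrs e x : {set V} := [set y | e x y].

Definition missing f x : {set C} := [set c | [forall y, f x y != Some c]].

Lemma missingP f x c : reflect (forall y, f x y <> Some c) (c \in missing f x).
Proof.
by rewrite inE; apply: (iffP forallP) => H y; [apply/eqP|apply/eqP/H].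
Qed.

Lemma seenP f x c : reflect (exists y, f x y = Some c) (c \notin missing f x).
Proof.
rewrite inE negb_forall; apply: (iffP existsP) => -[y].
  by rewrite negbK => /eqP; exists y.
by move=> /eqP H; exists y; rewrite negbK.
Qed.

Lemma card_missing e f x : colours e f -> #|missing f x| + #|nbrs e x| = #|C|.
Proof.
case=> fC fe fI; rewrite -(cardsC (missing f x)); congr (_ + _).
have si : injective (@Some C) by move=> ? ? [].
rewrite -(card_imset _ si).
rewrite -(card_in_imset (f := f x) (D := mem (nbrs e x))); last first.
  move=> y z; rewrite !inE -!fe; case E: (f x y) => [c|] // _ _ /esym E'.
  exact: fI E E'.
apply: eq_card => o; apply/imsetP/imsetP => -[].
  move=> y; rewrite inE -fe; case E: (f x y) => [c|] // _ ->; exists c => //.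
  by rewrite inE; apply/seenP; exists y.
move=> c; rewrite inE => /seenP[y E] ->; exists y => //.
by rewrite inE -fe E.
Qed.

(** * Kempe chains *)

Section Kempe.
Variables (e : rel V) (f : V -> V -> option C).
Hypothesis fP : colours e f.

(** A colour class is a matching. The default [x] turns it into an involution of all of [V] that
    fixes every vertex missing [c]. *)
Let mate c x := odflt x [pick y | f x y == Some c].

Let mateK c : involutive (mate c).
Proof.
case: fP => fC fe fI x; rewrite /mate.
case: pickP => [y /= /eqP E|N] /=; last by case: pickP => // y; rewrite N.
case: pickP => [z /= /eqP E'|/(_ x)] /=; first by rewrite fC in E; exact: fI E' E.
by rewrite fC E eqxx.
Qed.

Let mate_some c x y : f x y = Some c -> mate c x = y.
Proof.
case: fP => fC fe fI E; rewrite /mate; case: pickP => [z /= /eqP E'|/(_ y)] /=.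
  exact: fI E' E.
by rewrite E eqxx.
Qed.

Let mate_missing c x : c \in missing f x -> mate c x = x.
Proof.
move/missingP=> N; rewrite /mate; case: pickP => [z /eqP/N //|//].
Qed.

Variables (a b : C) (v : V).
Hypothesis va : a \in missing f v.

(** Two steps along the chain. As [a] is missing at [v], the cycle of [v] under this permutation is
    closed under both involutions, so it is the whole chain of [v]. *)
Let rot x := mate a (mate b x).
Let rot_inj : injective rot.
Proof. by apply: inj_comp; apply: inv_inj; exact: mateK. Qed.

Let chain := [set x | fconnect rot v x].

Let chain_iter n : iter n rot v \in chain.
Proof. by rewrite inE fconnect_iter. Qed.

Let mate_a_iter n : rot (mate a (iter n.+1 rot v)) = mate a (iter n rot v).
Proof. by rewrite iterS /rot !mateK. Qed.

Let iter_mate_a n : iter n rot (mate a (iter n rot v)) = v.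
Proof.
elim: n => [|n IH]; first exact: mate_missing.
by rewrite iterSr mate_a_iter.
Qed.

Let mate_b_rot x : mate b x = mate a (rot x).
Proof. by rewrite /rot mateK. Qed.

Let chain_of_iter n x : iter n rot x = v -> x \in chain.
Proof.
move=> E; rewrite inE fconnect_sym; last exact: rot_inj.
by rewrite -E fconnect_iter.
Qed.

Let chainP x : x \in chain -> exists n, x = iter n rot v.
Proof. by rewrite inE => /iter_findex<-; exists (findex rot v x). Qed.

Let chain_mate c x : c \in [set a; b] -> x \in chain -> mate c x \in chain.
Proof.
case/set2P=> -> /chainP[n ->]; first exact: chain_of_iter (iter_mate_a n).
rewrite mate_b_rot; exact: chain_of_iter (iter_mate_a n.+1).
Qed.

Let iter_order_dvd n : iter n rot v = v -> order rot v %| n.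
Proof.
move=> E; have N0 := order_gt0 rot v.
have E2 : iter (n %% order rot v) rot v = v.
  rewrite -[RHS]E {2}(divn_eq n (order rot v)) addnC iterD.
  by congr iter; elim: (n %/ _) => //= m IH; rewrite mulSn iterD -IH iter_order.
have := findex_iter (ltn_pmod n N0); rewrite E2 findex0 => /esym /eqP //.
Qed.

(* On the orbit of v under rot, mate a acts as n |-> -n and mate b as
   n |-> -n-1, so the only endpoints of the chain are v and the vertex at half
   the period. *)
Let chain_end x : x \in chain -> x != v ->
  (a \in missing f x) || (b \in missing f x) ->
  x = iter (order rot v)./2 rot v.
Proof.
move=> xc xv ab; have [n nN E] : exists2 n, n < order rot v & x = iter n rot v.
  move: xc; rewrite inE => xc; exists (findex rot v x); first exact: findex_max.
  by rewrite iter_findex.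
have n0 : 0 < n by case: n E {nN} => // E; rewrite E eqxx in xv.
rewrite E; congr (iter _ rot v).
suff : order rot v %| n.*2 \/ order rot v %| n.*2.+1.
  (* Since [0 < n < order rot v], the quotient can only be 1, so [n] is half the period, rounded
     down. *)
  by case=> /dvdnP[[|[|q]] ?]; lia.
case/orP: ab => /mate_missing; rewrite {}E => E.
  left; apply: iter_order_dvd.
  by rewrite -addnn iterD -[iter n rot v]E iter_mate_a.
right; apply: iter_order_dvd.
by rewrite -addnn -addSn iterD -[iter n rot v]E mate_b_rot iter_mate_a.
Qed.

(* The swap is made outside the chain P of v, so that the colours at v and at
   the other end of P do not change. *)
Lemma kempe : exists (P : {set V}) f',
  [/\ colours e f', v \in P,
      forall x y, x \in P -> x != v -> y \in P -> y != v ->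
        (a \in missing f x) || (b \in missing f x) ->
        (a \in missing f y) || (b \in missing f y) -> x = y,
      forall x, x \in P -> forall y, f' x y = f x y
    & forall x, x \notin P -> forall y, f' x y = omap (tperm a b) (f x y)].
Proof.
exists chain; exists (fun x y => if x \in chain then f x y else omap (tperm a b) (f x y)).
split.
- case: fP => fC fe fI; split.
  + move=> x y; rewrite (fC y x); case E: (f x y) => [c|]; last by rewrite !if_same.
    case cab: (c \in [set a; b]); last first.
      rewrite /= tpermD ?if_same //; apply/eqP=> F; move: cab;
      by rewrite F !inE eqxx ?orbT.
    have E' : f y x = Some c by rewrite fC.
    (* An edge coloured [a] or [b] never leaves the chain, so both of its ends apply the same
       rule. *)
    suff -> : (x \in chain) = (y \in chain) by [].
    by apply/idP/idP=> /(chain_mate cab); rewrite ?(mate_some E) ?(mate_some E').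
  + by move=> x y; rewrite -fe; case: ifP => //; case: (f x y).
  + move=> x y z c; case: ifP => _; first exact: fI.
    case E: (f x y) => [c1|] //= -[<-]; case E': (f x z) => [c2|] //= -[/perm_inj E2].
    by rewrite E2 in E'; exact: fI E E'.
- exact: (chain_iter 0).
- by move=> x y xc xv yc yv xm ym; rewrite (chain_end xc) // (chain_end yc).
- by move=> x xc y; rewrite xc.
- by move=> x /negbTE-> y.
Qed.
End Kempe.

(** * Changing the colour of one edge *)

Definition upd f u v o : V -> V -> option C := fun x y =>
  if (x == u) && (y == v) || (x == v) && (y == u) then o else f x y.

Lemma cardsU_disjoint (T : finType) (A B : {set T}) :
  (forall t, t \in A -> t \in B -> False) -> #|A :|: B| = #|A| + #|B|.
Proof.
move=> H; rewrite cardsU (_ : A :&: B = set0) ?cards0 ?subn0 //.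
by apply/setP=> t; rewrite !inE; apply/negP=> /andP[/H].
Qed.

Lemma leq_cardsD1 (A : {set C}) c : #|A| <= #|A :\ c|.+1.
Proof. by rewrite (cardsD1 c A) -addn1 addnC leq_add2l leq_b1. Qed.

Lemma card_setD1 (A : {set C}) c : c \in A -> #|A| = #|A :\ c|.+1.
Proof. by move=> cA; rewrite (cardsD1 c A) cA. Qed.

Lemma card_setC (A : {set C}) : #|A| + #|~: A| = #|C|.
Proof. exact: cardsC. Qed.

Lemma eq_colours e e' f : e =2 e' -> colours e f -> colours e' f.
Proof. by move=> E [fC fe fI]; split=> // x y; rewrite -E. Qed.

Lemma colours_remove e f u v : colours e f -> colours (del e u v) (upd f u v None).
Proof.
move=> [fC fe fI]; split.
- by move=> x y; rewrite /upd fC orbC [(y == u) && _]andbC [(y == v) && _]andbC.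
- by move=> x y; rewrite /upd /del -fe; case: ifP; rewrite ?andbF ?andbT.
- by move=> x y z c; rewrite /upd; case: ifP => // _; case: ifP => // _; exact: fI.
Qed.

Lemma colours_add e f u v a : colours (del e u v) f -> u != v -> e u v -> e v u ->
  a \in missing f u -> a \in missing f v -> colours e (upd f u v (Some a)).
Proof.
move=> [fC fe fI] uv euv evu /missingP au /missingP av; split.
- by move=> x y; rewrite /upd fC orbC [(y == u) && _]andbC [(y == v) && _]andbC.
- move=> x y; rewrite /upd; case: ifP => [|N]; last by rewrite fe /del N andbT.
  by case/orP=> /andP[/eqP-> /eqP->]; rewrite ?euv ?evu.
- move=> x y z c; rewrite /upd; case: ifP => [|_]; case: ifP => [|_].
  + move=> /orP[]/andP[/eqP-> /eqP->] /orP[]/andP[] //.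
    * by move=> _ /eqP.
    * by move=> E; rewrite E in uv.
    * by move=> E; rewrite eq_sym E in uv.
    * by move=> _ /eqP.
  + by case/orP=> /andP[/eqP-> _] [<-]; [move=> /au | move=> /av].
  + by case/orP=> /andP[/eqP-> _] E [E2]; move: E; rewrite -E2; [move=> /au | move=> /av].
  + exact: fI.
Qed.

Lemma missing_upd f u v o x : x != u -> x != v -> missing (upd f u v o) x = missing f x.
Proof.
by move=> /negbTE xu /negbTE xv; apply/setP=> c; rewrite !inE /upd xu xv.
Qed.

(** * Multi-fans around an uncoloured edge *)

Section Uncolourable.
Variable e : rel V.
Hypotheses (e_sym : symmetric e) (e_irr : irreflexive e).
Hypothesis e_unc : ~ colourable e.

Definition near u v f := colours (del e u v) f.

Lemma adj_neq u v : e u v -> u != v.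
Proof. by apply: contraTneq => ->; rewrite e_irr. Qed.

Lemma near_sym u v f : near u v f -> near v u f.
Proof. by apply: eq_colours => x y; rewrite /del orbC. Qed.

Lemma near_edge u v f x y c : near u v f -> f x y = Some c -> e x y.
Proof. by case=> _ fe _ E; move: (fe x y); rewrite E /= => /esym /andP[]. Qed.

Lemma near_neq u v f x y c : near u v f -> f x y = Some c -> x != y.
Proof. by move=> fP /(near_edge fP) /adj_neq. Qed.

Lemma near_none u v f : near u v f -> f u v = None.
Proof.
by case=> _ fe _; move: (fe u v); rewrite /del !eqxx andbF; case: (f u v).
Qed.

Lemma near_some u v f x y : near u v f -> e x y -> (x, y) != (u, v) -> (x, y) != (v, u) ->
  exists c, f x y = Some c.
Proof.
case=> _ fe _ exy; rewrite !xpair_eqE => /negbTE n1 /negbTE n2.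
by move: (fe x y); rewrite /del exy n1 n2; case: (f x y) => // c _; exists c.
Qed.

(** A colour missing at both ends could be given to [uv], which would colour all of [e]. *)
Lemma near_missing_disj u v f c : e u v -> near u v f ->
  c \in missing f u -> c \in missing f v -> False.
Proof.
move=> euv fP cu cv; apply: e_unc; exists (upd f u v (Some c)).
by apply: colours_add; rewrite // ?(adj_neq euv) // e_sym.
Qed.

(** The uncoloured edge counts in the degree of [u] but uses no colour, hence the extra one. *)
Lemma card_near_end u v f : e u v -> near u v f ->
  #|missing f u| + #|nbrs e u| = #|C|.+1.
Proof.
move=> euv fP; rewrite -(card_missing u fP) (cardsD1 v) inE euv addnCA; congr _.+1.
congr (_ + #|pred_of_set _|); apply/setP=> x; rewrite !inE /del eqxx /=.
by rewrite (negbTE (adj_neq euv)) /= orbF andbC.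
Qed.

Lemma card_near u v f x : near u v f -> x != u -> x != v ->
  #|missing f x| + #|nbrs e x| = #|C|.
Proof.
move=> fP /negbTE xu /negbTE xv; rewrite -(card_missing x fP).
by congr (_ + #|pred_of_set _|); apply/setP=> y; rewrite !inE /del xu xv andbT.
Qed.

(** One step of shifting a fan: [vu] takes the colour [c] of [vy], and [vy] becomes the uncoloured
    edge. Only [u] can lose a missing colour. *)
Lemma near_shift v u y f c : e v u -> near v u f -> f v y = Some c -> c \in missing f u ->
  exists f', [/\ near v y f', missing f' v = missing f v,
     c \in missing f' y /\ missing f y \subset missing f' y,
     forall z, z != v -> z != u -> z != y -> missing f' z = missing f z
   & forall x z, (x, z) != (v, u) -> (x, z) != (u, v) ->
      (x, z) != (v, y) -> (x, z) != (y, v) -> f' x z = f x z].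
Proof.
move=> evu fP fy cu; have vy := near_neq fP fy; have vu := adj_neq evu.
have yu : y != u by apply: contraPneq fy => ->; rewrite (near_none fP).
have [fC fe fI] := fP; have fy' : f y v = Some c by rewrite fC.
pose g := upd f v y None.
have gv d : (d \in missing g v) = (d \in missing f v) || (d == c).
  apply/missingP/orP => [N|[/missingP N|/eqP->] z]; rewrite ?/g /upd ?eqxx /=.
  - have [->|dc] := eqVneq d c; first by right.
    left; apply/missingP=> z; have := N z; rewrite /g /upd eqxx /=; case: eqP => [-> _|_].
      by rewrite fy => -[E]; rewrite E eqxx in dc.
    by rewrite (negbTE vy).
  - by case: ifP.
  - by case: eqP => //= zy; rewrite (negbTE vy) /= => E; apply: zy; apply: fI E fy.
have gy d : (d \in missing g y) = (d \in missing f y) || (d == c).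
  apply/missingP/orP => [N|[/missingP N|/eqP->] z]; rewrite ?/g /upd ?eqxx /=.
  - have [->|dc] := eqVneq d c; first by right.
    left; apply/missingP=> z; have := N z; rewrite /g /upd eqxx eq_sym (negbTE vy) /=.
    case: eqP => [-> _|_] //.
    by rewrite fy' => -[E]; rewrite E eqxx in dc.
  - by case: ifP.
  - rewrite [y == v]eq_sym (negbTE vy) /=; case: eqP => //= zv E; apply: zv; exact: fI E fy'.
have gz z : z != v -> z != y -> missing g z = missing f z by exact: missing_upd.
have gP : colours (del (del e v y) v u) g.
  have := colours_remove v y fP; apply: eq_colours => x z; rewrite /del -!andbA.
  by congr (_ && _); rewrite andbC.
exists (upd g v u (Some c)); split.
- apply: colours_add gP _ _ _ _ _; rewrite /del ?evu ?[e u v]e_sym ?evu ?gv ?eqxx ?orbT //=.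
  + by rewrite [u == y]eq_sym (negbTE yu) (negbTE vy).
  + by rewrite [u == v]eq_sym [u == y]eq_sym (negbTE yu) (negbTE vu).
  + by rewrite gz // eq_sym.
- apply/setP=> d; apply/missingP/missingP => N z; have := N z; rewrite /g /upd !eqxx /=.
  + rewrite (negbTE vu) (negbTE vy) /= !orbF; case: eqP => [-> _|_]; first by rewrite (near_none fP).
    case: eqP => // -> _; rewrite fy => -[E]; have := N u; rewrite /upd !eqxx -E //.
  + rewrite (negbTE vu) (negbTE vy) /= !orbF; case: eqP => [_ _ [E]|_]; last by case: ifP.
    by have := N y; rewrite fy E.
- have -> : missing (upd g v u (Some c)) y = missing g y by rewrite missing_upd // eq_sym.
  by rewrite gy eqxx orbT; split => //; apply/subsetP=> d; rewrite gy => ->.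
- by move=> z zv zu zy; rewrite missing_upd // gz.
- move=> x z; rewrite !xpair_eqE => /negbTE n1 /negbTE n2 /negbTE n3 /negbTE n4.
  by rewrite /g /upd n1 n2 n3 n4.
Qed.

(** The colour [a], free at both ends of [vy], replaces [c] there. *)
Lemma near_recolour v u y f c a : e v u -> near v u f -> f v y = Some c ->
  a \in missing f v -> a \in missing f y ->
  exists f', [/\ near v u f', c \in missing f' v
   & forall x z, (x, z) != (v, y) -> (x, z) != (y, v) -> f' x z = f x z].
Proof.
move=> evu fP fy av ay; have vy := near_neq fP fy; have vu := adj_neq evu.
have yu : y != u by apply: contraPneq fy => ->; rewrite (near_none fP).
have [fC fe fI] := fP.
have ga x : (a \in missing f x) -> (a \in missing (upd f v y None) x).
  by move=> /missingP N; apply/missingP=> z; rewrite /upd; case: ifP.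
have dy : del e v u v y.
  by rewrite /del (near_edge fP fy) eqxx /= (negbTE yu) (negbTE vu).
have dy' : del e v u y v.
  by rewrite /del [e y v]e_sym (near_edge fP fy) eqxx /= (negbTE yu) [y == v]eq_sym (negbTE vy).
exists (upd (upd f v y None) v y (Some a)); split.
- by apply: colours_add (colours_remove v y fP) _ _ _ (ga _ av) (ga _ ay).
- apply/missingP=> z; rewrite /upd !eqxx /= (negbTE vy) /= orbF.
  case: eqP => [_ [E]|zy E]; last by apply: zy; exact: fI E fy.
  by move/missingP: av => /(_ y); rewrite fy E.
- move=> x z; rewrite !xpair_eqE => /negbTE n1 /negbTE n2.
  by rewrite /upd n1 n2.
Qed.

(** The [a]/[b] chain of [v] must end at [u]: otherwise swapping outside it would make [a] missing
    at both ends of the uncoloured edge. Hence any third vertex missing [a] or [b] lies off the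
    chain and is swapped. *)
Lemma near_kempe_out v u f a b : e v u -> near v u f ->
  a \in missing f v -> b \in missing f u ->
  exists f', [/\ near v u f', f' v =1 f v, f' u =1 f u,
    forall x y c, f x y = Some c -> c != a -> c != b -> f' x y = Some c
  & forall x, x != v -> x != u -> (a \in missing f x) || (b \in missing f x) ->
     forall y, f' x y = omap (tperm a b) (f x y)].
Proof.
move=> evu fP av bu.
have [P [f' [f'P vP Puniq fin fout]]] := kempe fP b av.
have uP : u \in P.
  apply/negPn/negP => uP; apply: (@near_missing_disj v u f' a evu f'P).
    by apply/missingP=> y; rewrite fin //; exact/missingP.
  apply/missingP=> y; rewrite fout //; case E: (f u y) => [d|] //= -[].
  rewrite -[in RHS](tpermR a b) => /perm_inj E'; move/missingP: bu => /(_ y).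
  by rewrite E E'.
exists f'; split=> //; [exact: fin | exact: fin | |].
  move=> x y c E ca cb; have [xP|xP] := boolP (x \in P); first by rewrite fin.
  by rewrite fout // E /= tpermD // eq_sym.
move=> x xv xu xm y; apply: fout; apply/negP => xP; move: xu.
rewrite (Puniq x u) ?eqxx ?bu ?orbT //.
by rewrite eq_sym (adj_neq evu).
Qed.

(** The vertices reachable from [u] are those of the maximal multi-fan at [v] that starts with the
    uncoloured edge [vu]. *)
Definition fan f v : rel V := fun x y => if f v y is Some c then c \in missing f x else false.

(** Shifting the uncoloured edge along the path, one fan edge at a time, reduces this to
    [near_missing_disj]. The path is first made simple, so that the vertex losing a colour in a
    shift does not recur later. *)
Lemma fan_missing_center v u f p c : e v u -> near v u f -> path (fan f v) u p ->
  c \in missing f (last u p) -> c \in missing f v -> False.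
Proof.
move=> evu fP up; case/shortenP: up => q uq Uq _ {p}.
elim: q u f evu fP uq Uq => [|y q IH] u f evu fP /=.
  by move=> _ _ cu cv; exact: near_missing_disj evu fP cv cu.
case/andP; rewrite {1}/fan; case fy: (f v y) => [d|] // du yq /andP[uyq Uyq] cl cv.
have [f' [f'P f'v [_ f'y] f'z f'E]] := near_shift evu fP fy du.
have vNq z : z \in q -> z != v.
  move=> zq; apply/eqP => zv; move: yq; rewrite zv in zq.
  elim: (q) (y) zq => //= t s IHs t'; rewrite inE => /orP[/eqP<-|/IHs H] /andP[].
    by rewrite /fan; case E: (f v v) => [g|] //; have := near_neq fP E; rewrite eqxx.
  by move=> _ /H.
have vNyq z : z \in y :: q -> z != v.
  by rewrite inE => /predU1P[->|/vNq//]; rewrite eq_sym; exact: near_neq fP fy.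
have msub z : z \in y :: q -> missing f z \subset missing f' z.
  rewrite inE; have [-> //|zy /= zq] := eqVneq z y.
  rewrite f'z ?vNq //; apply: contraNneq uyq => <-; by rewrite inE zq orbT.
have uNq z : z \in q -> z != u by apply: contraTneq => ->; move: uyq; rewrite inE => /norP[].
have yNq z : z \in q -> z != y by apply: contraTneq => ->; case/andP: Uyq.
apply: (IH y f') => //; rewrite ?f'v //.
- exact: near_edge fP fy.
- apply: sub_path_tail yq => s t sq tq; rewrite /fan f'E.
  + by case: (f v t) => // g; apply: subsetP; apply: msub; exact: mem_belast.
  + by rewrite xpair_eqE (negbTE (uNq _ tq)) andbF.
  + by rewrite xpair_eqE (negbTE (vNq _ tq)) andbF.
  + by rewrite xpair_eqE (negbTE (yNq _ tq)) andbF.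
  + by rewrite xpair_eqE (negbTE (vNq _ tq)) andbF.
- by apply: subsetP cl; apply: msub; exact: mem_last.
Qed.

Lemma fan_center_disj v u f y c : e v u -> near v u f -> connect (fan f v) u y ->
  c \in missing f y -> c \in missing f v -> False.
Proof. by move=> evu fP /connectP[p up ->]; exact: fan_missing_center. Qed.

(** Take the [a]/[c] chain of [v]. Two distinct fan vertices missing [c] would both lie on it, but
    apart from [v] the chain has room for only one end. *)
Lemma fan_disj v u f y y' a c : e v u -> near v u f -> a \in missing f v ->
  connect (fan f v) u y -> connect (fan f v) u y' -> y != y' ->
  c \in missing f y -> c \in missing f y' -> False.
Proof.
move=> evu fP av uy uy' yy' cy cy'.
have [P [f' [f'P vP Puniq fin fout]]] := kempe fP c av.
have avf' : a \in missing f' v by apply/missingP=> z; rewrite fin //; exact/missingP.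
(* If the last vertex were off the chain, the swap would make [a] missing there. The path would
   remain a fan, since no edge at [v] has colour [a], and [c] is used only at vertices of [P], which
   do not change. This contradicts [fan_missing_center]. *)
have inP q : path (fan f v) u q -> c \in missing f (last u q) ->
    (forall s, s \in belast u q -> c \in missing f s -> s \in P) -> last u q \in P.
  move=> uq cq qP; apply/negPn/negP=> lP.
  apply: (@fan_missing_center v u f' q a evu f'P _ _ avf'); last first.
    apply/missingP=> t; rewrite fout //; case E: (f _ t) => [d|] //= -[].
    rewrite -[in RHS](tpermR a c) => /perm_inj E'; move/missingP: cq => /(_ t).
    by rewrite E E'.
  apply: sub_path_tail uq => s t sq _; rewrite /fan fin //; case E: (f v t) => [d|] //.
  move=> ds; have [sP|sP] := boolP (s \in P).
    by apply/missingP=> z; rewrite fin //; exact/missingP.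
  have dc : c != d by apply: contraNneq sP => cd; apply: qP; rewrite ?cd.
  have da : a != d by apply: contraPneq E => <-; exact/missingP.
  apply/missingP=> z; rewrite fout //; case E': (f s z) => [g|] //= -[].
  rewrite -[in RHS](tpermD da dc) => /perm_inj E2; move/missingP: ds => /(_ z).
  by rewrite E' E2.
have neqv q : path (fan f v) u q -> c \in missing f (last u q) -> last u q != v.
  move=> uq cq; apply: contraPneq (cq) => qv cv; rewrite qv in cv.
  exact: fan_missing_center uq cq cv.
have /connectP[p up ep] := uy; have cp := cy; rewrite ep in cp.
have [q [uq cq qN]] := path_to_first (Q := fun x => c \in missing f x) up cp.
have qP : last u q \in P.
  by apply: inP uq cq _ => s sq cs; case/hasP: qN; exists s.
(* [last u q] need not be [y], so the second vertex is whichever of [y] and [y'] differs from it. *)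
have [z uz [cz zq]] : exists2 z, connect (fan f v) u z & c \in missing f z /\ z != last u q.
  have [E|N] := eqVneq y (last u q); [exists y' => // | by exists y].
  by split; rewrite // -E eq_sym.
have /connectP[r ur er] := uz; rewrite {}er in cz zq.
have [s [us /andP[cs sq] sN]] :=
  path_to_first (Q := fun x => (c \in missing f x) && (x != last u q)) ur (introT andP (conj cz zq)).
have sP : last u s \in P.
  apply: inP us cs _ => t ts ct; have [-> //|tq] := eqVneq t (last u q).
  by case/hasP: sN; exists t; rewrite ?ct.
move/negP: sq; apply; apply/eqP; apply: Puniq => //; rewrite ?cs ?cq ?orbT //; exact: neqv.
Qed.

Hypothesis e_deg : forall x, #|nbrs e x| <= #|C|.

Lemma near_missing_center v u f : e v u -> near v u f -> exists a, a \in missing f v.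
Proof.
move=> evu fP; apply/set0Pn; rewrite -card_gt0.
by have := card_near_end evu fP; have := e_deg v; lia.
Qed.

(** The missing sets at the two ends are disjoint and each is one larger than the degree alone would
    give. *)
Lemma near_degree_sum v u f : e v u -> near v u f -> #|C| + 2 <= #|nbrs e v| + #|nbrs e u|.
Proof.
move=> evu fP; have euv : e u v by rewrite e_sym.
have := card_near_end evu fP; have := card_near_end euv (near_sym fP).
have := cardsU_disjoint (fun c => near_missing_disj (c := c) evu fP).
have : #|missing f v :|: missing f u| <= #|C| by exact: max_card.
by lia.
Qed.

Lemma fan_center_neq v u f y : e v u -> near v u f -> connect (fan f v) u y -> y != v.
Proof.
move=> evu fP uy; apply: contraPneq uy => -> vv; have [a av] := near_missing_center evu fP.
exact: (fan_center_disj evu fP vv av av).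
Qed.

Lemma fan_card v u f y : e v u -> near v u f -> connect (fan f v) u y -> y != u ->
  #|missing f y| + #|missing f u| + #|missing f v| <= #|C|.
Proof.
move=> evu fP uy yu; have [a av] := near_missing_center evu fP.
rewrite -!cardsU_disjoint ?max_card // => c.
  case/setUP=> cx cv; first exact: (fan_center_disj evu fP uy cx cv).
  exact: (near_missing_disj evu fP cv cx).
exact: (fan_disj evu fP av uy (connect0 _ u) yu).
Qed.

Lemma fan_step v u f y c : f v y = Some c -> c \in missing f u -> connect (fan f v) u y.
Proof. by move=> E cu; apply: connect1; rewrite /fan E. Qed.

(** A colour missing at [u] occurs on some edge [vz]. Disjointness in the fan gives [z] degree at
    least [#|missing f u| + #|missing f v| > k], so [z] lies in [K]. Thus
    [k <= #|missing f u| <= #|K| <= k], with equality throughout. *)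
Lemma fan_image k v u f (K : {set V}) : 2 * k <= #|C|.+1 -> e v u -> near v u f ->
  #|nbrs e u| <= k -> #|K| <= k -> (forall y, e v y -> k < #|nbrs e y| -> y \in K) ->
  [/\ #|C|.+1 = 2 * k, #|nbrs e u| = k, #|K| = k &
      f v @: K = [set Some d | d in missing f u]].
Proof.
move=> Ck evu fP du Kk Kin; have euv : e u v by rewrite e_sym.
have si : injective (@Some C) by move=> ? ? [].
have Mu := card_near_end euv (near_sym fP).
have sub : [set Some d | d in missing f u] \subset f v @: K.
  apply/subsetP=> _ /imsetP[d d_u ->].
  have /seenP[z fz] : d \notin missing f v.
    by apply/negP=> dv; exact: (near_missing_disj evu fP dv d_u).
  apply/imsetP; exists z => //; have uz := fan_step fz d_u.
  have zu : z != u by apply: contraPneq fz => ->; rewrite (near_none fP).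
  have zv := fan_center_neq evu fP uz.
  apply: Kin (near_edge fP fz) _.
  have := fan_card evu fP uz zu; have := card_near fP zv zu.
  have [a av] := near_missing_center evu fP.
  have : 0 < #|missing f v| by apply/card_gt0P; exists a.
  by move: Mu du Ck; clear; lia.
have le1 := subset_leq_card sub; rewrite (card_imset _ si) in le1.
have le2 : #|f v @: K| <= #|K| by exact: leq_imset_card.
have E : #|missing f u| = k by move: le1 le2 Mu du Kk Ck; clear; lia.
split; [by move: E Mu du Ck; clear; lia | by move: E Mu du Ck; clear; lia | by move: E le1 le2 Kk; clear; lia |].
by apply/esym/eqP; rewrite eqEcard sub (card_imset _ si) E (leq_trans le2).
Qed.

(** If [y] missed a colour [d], the edge of colour [d] at [v] would lead to a further fan vertex in
    [K]. By the equality case [d] would then be missing at [u] too, against [fan_disj]. *)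
Lemma fan_big k v u f (K : {set V}) y : 2 * k <= #|C|.+1 -> e v u -> near v u f ->
  #|nbrs e u| <= k -> #|K| <= k -> (forall y, e v y -> k < #|nbrs e y| -> y \in K) ->
  y \in K -> e v y /\ #|nbrs e y| = #|C|.
Proof.
move=> Ck evu fP du Kk Kin yK.
have [Ck' du' Kk' img] := fan_image Ck evu fP du Kk Kin.
have inK z : z \in K -> exists2 c, c \in missing f u & f v z = Some c.
  move=> zK; have : f v z \in [set Some d | d in missing f u] by rewrite -img imset_f.
  by move=> /imsetP[d dz ->]; exists d.
have [c cu fy] := inK y yK; split; first exact: near_edge fP fy.
have uy := fan_step fy cu; have yv := fan_center_neq evu fP uy.
have yu : y != u by apply: contraPneq fy => ->; rewrite (near_none fP).
have := card_near fP yv yu; rewrite (_ : missing f y = set0) ?cards0 //.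
apply/setP=> d; rewrite in_set0; apply/negbTE/negP => dy.
have /seenP[z fz] : d \notin missing f v.
  by apply/negP=> dv; exact: (fan_center_disj evu fP uy dy dv).
have uz : connect (fan f v) u z by apply: connect_trans uy (fan_step fz dy).
have zu : z != u by apply: contraPneq fz => ->; rewrite (near_none fP).
have zv := fan_center_neq evu fP uz.
have zK : z \in K.
  apply: Kin (near_edge fP fz) _.
  have := fan_card evu fP uz zu; have := card_near fP zv zu.
  have [a av] := near_missing_center evu fP.
  have : 0 < #|missing f v| by apply/card_gt0P; exists a.
  have euv : e u v by rewrite e_sym.
  have := card_near_end euv (near_sym fP).
  by move: du Ck; clear; lia.
have [g gu] := inK z zK; rewrite fz => -[dg]; rewrite -dg in gu.
have [a av] := near_missing_center evu fP.
exact: (fan_disj evu fP av uy (connect0 _ u) yu dy gu).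
Qed.

Variable k : nat.
Hypotheses (k_ge4 : 4 <= k) (C_card : #|C|.+1 = 2 * k).

Ltac card_lia := clear -k_ge4 C_card; lia.

(** * The equality case of the fan bound *)

Section TightVertex.
Variables (v u : V) (K : {set V}).
Hypotheses (evu : e v u) (deg_u : #|nbrs e u| = k) (deg_v : k < #|nbrs e v|).
Hypotheses (K_card : #|K| = k)
  (K_out : forall y, e v y -> y \notin K -> #|nbrs e y| = k).

Let vu : v != u. Proof. exact: adj_neq. Qed.
Let euv : e u v. Proof. by rewrite e_sym. Qed.

Let card_u f : near v u f -> #|missing f u| = k.
Proof. by move=> fP; have := card_near_end euv (near_sym fP); rewrite deg_u; card_lia. Qed.

Lemma tight_colours f y c : near v u f -> y \in K -> f v y = Some c -> c \in missing f u.
Proof.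
move=> fP yK fy.
have Kin z : e v z -> k < #|nbrs e z| -> z \in K.
  by move=> evz; apply: contraTT => zK; rewrite K_out ?ltnn.
have [|||_ _ _ E] := fan_image _ evu fP _ _ Kin; rewrite ?C_card ?deg_u ?K_card //.
have : f v y \in [set Some d | d in missing f u] by rewrite -E imset_f.
by rewrite fy => /imsetP[d du [->]].
Qed.

(* c0 is the colour of an edge to be preserved. *)
Lemma tight_release f c c0 : near v u f -> c \notin missing f u -> c \notin missing f v ->
  c0 \notin missing f v ->
  exists f', [/\ near v u f', c \in missing f' v, missing f' u = missing f u,
    f' u =1 f u & forall x y, x != v -> y != v -> f x y = Some c0 -> f' x y = Some c0].
Proof.
move=> fP cu /seenP[w fw] c0v; have [fC fe fI] := fP.
have wK : w \notin K by apply: contra cu => wK; exact: tight_colours wK fw.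
have dw := K_out (near_edge fP fw) wK; have vw := near_neq fP fw.
have wu : w != u by apply: contraPneq fw => ->; rewrite (near_none fP).
have [a av] := near_missing_center evu fP.
have au : a \notin missing f u by apply/negP; exact: near_missing_disj av.
have Mw : #|missing f w| = k.-1.
  by have := card_near fP _ wu; rewrite dw eq_sym vw => /(_ isT); card_lia.
have cw : c \notin missing f w by apply/seenP; exists v; rewrite fC.
have [f1 [f1P f1v f1u f1w f1c]] : exists f1, [/\ near v u f1, f1 v =1 f v, f1 u =1 f u,
    a \in missing f1 w & forall x y, f x y = Some c0 -> f1 x y = Some c0].
  have [aw|aw] := boolP (a \in missing f w); first by exists f.
  (* Only [k-1] colours are seen at [u]. Two of them, [a] and [c], are also seen at [w], so at least
     two of the [k-1] colours missing at [w] are missing at [u]; one of these is not [c0]. *)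
  have [g gw] : exists g, g \in (missing f w :&: missing f u) :\ c0.
    apply/card_gt0P.
    have ac : a != c by apply: contraPneq fw => <-; exact/missingP.
    have /subset_leq_card : missing f w :\: missing f u \subset
        (~: missing f u) :\ a :\ c.
      apply/subsetP=> d /setDP[dw' du]; rewrite 2!in_setD1 in_setC du andbT.
      by apply/andP; split; apply: contraTneq dw' => ->.
    have := leq_cardsD1 (missing f w :&: missing f u) c0.
    have := card_setC (missing f u).
    have := card_u fP.
    have := @card_setD1 (~: missing f u) a; have := @card_setD1 ((~: missing f u) :\ a) c.
    rewrite in_setD1 !in_setC cu au [c == a]eq_sym ac => /(_ isT) + /(_ isT).
    have := cardsID (missing f u) (missing f w); rewrite Mw.
    by card_lia.
  move: gw; rewrite !inE => /andP[gc0 /andP[/forallP gw /forallP gu]].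
  have gu' : g \in missing f u by rewrite inE; apply/forallP.
  have gw' : g \in missing f w by rewrite inE; apply/forallP.
  have [f1 [f1P f1v f1u f1c f1x]] := near_kempe_out evu fP av gu'.
  exists f1; split=> //.
    apply/missingP=> y; rewrite f1x // 1?eq_sym ?gw' ?orbT //.
    case E: (f w y) => [d|] //= -[]; rewrite -[in RHS](tpermR a g) => /perm_inj E'.
    by move: (gw y); rewrite E E' eqxx.
  move=> x y E; apply: f1c E _ _; last by rewrite eq_sym.
  by apply: contraNneq c0v => ->.
have av1 : a \in missing f1 v by apply/missingP=> z; rewrite f1v; exact/missingP.
have fw1 : f1 v w = Some c by rewrite f1v.
(* Recolouring [vw] from [c] to [a] releases [c] at [v]. *)
have [f2 [f2P f2v f2E]] := near_recolour evu f1P fw1 av1 f1w.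
have f2u : f2 u =1 f u.
  move=> x; rewrite f2E ?f1u // xpair_eqE eq_sym ?(negbTE vu) //.
  by rewrite (negbTE wu).
exists f2; split=> //.
  by apply/setP=> d; rewrite !inE; apply: eq_forallb => x; rewrite f2u.
move=> x y xv yv E; rewrite f2E ?f1c // xpair_eqE ?(negbTE xv) ?(negbTE yv) ?andbF //.
Qed.

(* Kempe changes make f u y missing at v and f y z missing at u; moving the
   colour of uy to uv then puts u and z in one fan at y, which has too few
   colours. *)
Lemma tight_distance2 y z f : near v u f -> e u y -> y != v -> e y z -> z != u ->
  k < #|nbrs e z|.
Proof.
move=> f0P euy yv eyz zu; rewrite ltnNge; apply/negP=> dz.
have yu : y != u by rewrite eq_sym adj_neq.
have zv : z != v by apply: contraTneq dz => ->; rewrite -ltnNge.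
have zy : z != y by rewrite eq_sym adj_neq.
have zcard g : near v u g -> k.-1 <= #|missing g z|.
  by move=> gP; have := card_near gP zv zu; move: dz; card_lia.
have colour_uy g : near v u g -> exists2 a, g u y = Some a & a \notin missing g u.
  move=> gP; have [||a E] := near_some gP euy; last by exists a; rewrite //; apply/seenP; exists y.
    by rewrite xpair_eqE eq_sym (negbTE vu).
  by rewrite xpair_eqE (negbTE yv) andbF.
have colour_yz g : near v u g -> exists c, g y z = Some c.
  move=> gP; have [||c E] := near_some gP eyz; last by exists c.
    by rewrite xpair_eqE (negbTE zu) andbF.
  by rewrite xpair_eqE (negbTE zv) andbF.
(* In the fan at [y] started at [u], the vertices [u], [z] and [y] miss at least [k], [k-1] and 1
   colours, which is one too many for [2k-1] colours. *)
have shifted g a c : near v u g -> g u y = Some a -> g y z = Some c ->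
    a \in missing g v -> c \in missing g u -> False.
  move=> gP gy gz av cu.
  have [g1 [g1P g1u [ay _] g1z g1E]] := near_shift euv (near_sym gP) gy av.
  have eyu : e y u by rewrite e_sym.
  have g1yz : g1 y z = Some c.
    by rewrite g1E // xpair_eqE ?(negbTE yu) ?(negbTE yv) ?(negbTE zu) ?andbF.
  rewrite -g1u in cu.
  have := fan_card eyu (near_sym g1P) (fan_step g1yz cu) zu.
  rewrite g1u g1z // (card_u gP).
  have : 0 < #|missing g1 y| by apply/card_gt0P; exists a.
  by have := zcard _ gP; card_lia.
(* [tight_release] frees the colour of [uy] at [v] while keeping the colour [c] of [yz]. *)
have seen_u g a c : near v u g -> g u y = Some a -> g y z = Some c -> c \in missing g u -> False.
  move=> gP gy gz cu; have [av|av] := boolP (a \in missing g v); first exact: (shifted g a c).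
  have au : a \notin missing g u by apply/seenP; exists y.
  have cv : c \notin missing g v by apply/negP=> cv; exact: (near_missing_disj evu gP cv cu).
  have [g' [g'P ag' g'u g'uE g'c]] := tight_release gP au av cv.
  by apply: (shifted g' a c) => //; rewrite ?g'uE ?g'u // g'c.
have missing_v g c : near v u g -> g y z = Some c -> c \in missing g v -> False.
  move=> gP gz cv; have [a gy au] := colour_uy g gP.
  have cu : c \notin missing g u by apply/negP=> cu; exact: (near_missing_disj evu gP cv cu).
  have gz' : g z y = Some c by case: gP => <-.
  have cz : c \notin missing g z by apply/seenP; exists y.
  (* At most [k-2] colours avoid both [c] and [missing g u], whereas [z] misses at least [k-1]. The
     swap of [c] and the resulting [d] gives [yz] a colour missing at [u]. *)
  have /subsetPn[d dz'] : ~~ (missing g z \subset ~: (c |: missing g u)).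
    apply/negP=> /subset_leq_card; have := zcard _ gP; have := card_u gP.
    have := card_setC (c |: missing g u).
    by rewrite cardsU1 cu; card_lia.
  rewrite in_setC negbK in_setU1 => /orP[/eqP dc|du]; first by rewrite -dc dz' in cz.
  have [g' [g'P g'v g'u _ g'x]] := near_kempe_out evu gP cv du.
  apply: (seen_u g' a d) => //; rewrite ?g'u //.
    case: g'P => g'C _ _; rewrite g'C g'x ?dz' ?orbT //.
    by rewrite gz' /= tpermL.
  by apply/missingP=> x; rewrite g'u; exact/missingP.
have [c fz] := colour_yz f f0P.
have [cu|cu] := boolP (c \in missing f u).
  by have [a fy _] := colour_uy f f0P; exact: (seen_u f a c).
have [cv|cv] := boolP (c \in missing f v); first exact: (missing_v f c).
have [g [gP cg _ _ gc]] := tight_release f0P cu cv cv.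
by apply: (missing_v g c) => //; exact: gc.
Qed.

End TightVertex.

(* Kempe changes make f w z1 and f w z2 missing at v; moving the colour of vw to
   uv then puts v, z1 and z2 in one fan at w. *)
Lemma light_neighbours v u w z1 z2 f : near v u f -> e v u -> #|nbrs e u| = k ->
  #|nbrs e v| = k.+1 -> e v w -> w != u -> e w z1 -> e w z2 -> z1 != v -> z2 != v ->
  #|nbrs e z1| <= k.+1 -> #|nbrs e z2| <= k.+1 -> z1 = z2.
Proof.
move=> f0P evu deg_u deg_v evw wu ewz1 ewz2 z1v z2v deg1 deg2.
apply/eqP/negPn/negP=> z12.
have euv : e u v by rewrite e_sym.
have ewv : e w v by rewrite e_sym.
have wv := adj_neq ewv.
have card_u g : near v u g -> #|missing g u| = k.
  by move=> gP; have := card_near_end euv (near_sym gP); rewrite deg_u; card_lia.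
have card_v g : near v u g -> #|missing g v| = k.-1.
  by move=> gP; have := card_near_end evu gP; rewrite deg_v; card_lia.
(* The two missing sets are disjoint of sizes [k] and [k-1], so they partition the [2k-1]
   colours. *)
have missing_uv g c : near v u g -> c \notin missing g u -> c \in missing g v.
  move=> gP cu; apply/negPn/negP=> cv.
  have := cardsU_disjoint (fun c => near_missing_disj (c := c) evu gP).
  rewrite card_u // card_v //; have : c \notin missing g v :|: missing g u by rewrite inE negb_or cv.
  rewrite -in_setC => N; have : 0 < #|~: (missing g v :|: missing g u)| by apply/card_gt0P; exists c.
  have := card_setC (missing g v :|: missing g u).
  by card_lia.
have colour_w g z : near v u g -> e w z -> z != v -> exists c, g w z = Some c.
  move=> gP ewz zv; have [||c E] := near_some gP ewz; last by exists c.
    by rewrite xpair_eqE (negbTE wv).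
  by rewrite xpair_eqE (negbTE wu).
have both g b1 b2 : near v u g -> g w z1 = Some b1 -> g w z2 = Some b2 ->
    b1 \in missing g v -> b2 \in missing g v -> False.
  move=> gP g1 g2 b1v b2v.
  have [||d gw] := near_some gP evw; rewrite ?xpair_eqE ?eqxx ?(negbTE wu) ?(negbTE wv) ?andbF //.
  have du : d \in missing g u.
    apply/negPn/negP=> /(missing_uv _ _ gP) /missingP/(_ w); by rewrite gw.
  have [h [hP hv [hw _] hz hE]] := near_shift evu gP gw du.
  have hz1 : h w z1 = Some b1.
    by rewrite hE // xpair_eqE ?(negbTE wu) ?(negbTE wv) ?(negbTE z1v) ?andbF.
  have hz2 : h w z2 = Some b2.
    by rewrite hE // xpair_eqE ?(negbTE wu) ?(negbTE wv) ?(negbTE z2v) ?andbF.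
  rewrite -hv in b1v b2v; have hP' := near_sym hP.
  have vz1 := fan_step hz1 b1v; have vz2 := fan_step hz2 b2v.
  have z1w := fan_center_neq ewv hP' vz1; have z2w := fan_center_neq ewv hP' vz2.
  have disj12 c := @fan_disj w v h z1 z2 d c ewv hP' hw vz1 vz2 z12.
  have disj1 c := @fan_disj w v h z1 v d c ewv hP' hw vz1 (connect0 _ v) z1v.
  have disj2 c := @fan_disj w v h z2 v d c ewv hP' hw vz2 (connect0 _ v) z2v.
  have dw1 c := fan_center_disj (c := c) ewv hP' vz1.
  have dw2 c := fan_center_disj (c := c) ewv hP' vz2.
  have dwv c := near_missing_disj (c := c) ewv hP'.
  (* The four disjoint sets have at least [2(k-2) + (k-1) + 1 = 3k-4] elements, which exceeds [2k-1]
     because [k >= 4]. *)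
  have : #|missing h z1 :|: missing h z2 :|: missing h v :|: missing h w| <= #|C| by exact: max_card.
  rewrite !cardsU_disjoint //.
  - have := card_near hP z1v z1w; have := card_near hP z2v z2w.
    rewrite hv card_v //.
    have : 0 < #|missing h w| by apply/card_gt0P; exists d.
    move: deg1 deg2.
    by card_lia.
  - by move=> c /setUP[]; [exact: disj1 | exact: disj2].
  - move=> c /setUP[/setUP[]|] H cw; [exact: (dw1 c)|exact: (dw2 c)|exact: (dwv c)].
(* Makes the colour of [wz] missing at [v] without disturbing [b0], the colour of the other edge
   treated before. *)
have bring g z c b0 : near v u g -> e w z -> z != u -> z != v -> #|nbrs e z| <= k.+1 ->
    g w z = Some c -> b0 \in missing g v -> c != b0 -> exists g' c',
    [/\ near v u g', g' w z = Some c', c' \in missing g' v, b0 \in missing g' v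
      & forall x y, g x y = Some b0 -> g' x y = Some b0].
  move=> gP ewz zu zv dz gz b0v cb0.
  have [cv|cv] := boolP (c \in missing g v); first by exists g, c.
  have cu : c \in missing g u.
    by apply/negPn/negP=> cu; rewrite (missing_uv _ _ gP cu) in cv.
  have gz' : g z w = Some c by case: gP => <-.
  (* A colour [m] missing at both [v] and [z] is exchanged with [c], which is missing at [u]; then
     [wz] has colour [m]. *)
  have step g1 m : near v u g1 -> g1 v =1 g v -> g1 u =1 g u -> g1 z w = Some c ->
      (forall x y, g x y = Some b0 -> g1 x y = Some b0) ->
      m \in missing g v -> m \in missing g1 z -> m != b0 ->
      exists g' c', [/\ near v u g', g' w z = Some c', c' \in missing g' v, b0 \in missing g' v
      & forall x y, g x y = Some b0 -> g' x y = Some b0].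
    move=> g1P g1v g1u g1z g1b mv mz mb0.
    have mv1 : m \in missing g1 v by apply/missingP=> x; rewrite g1v; exact/missingP.
    have cu1 : c \in missing g1 u by apply/missingP=> x; rewrite g1u; exact/missingP.
    have [g' [g'P g'v g'u g'c g'x]] := near_kempe_out evu g1P mv1 cu1.
    exists g', m; split=> //.
    - by case: g'P => -> _ _; rewrite g'x ?mz // g1z /= tpermR.
    - by apply/missingP=> x; rewrite g'v; exact/missingP.
    - by apply/missingP=> x; rewrite g'v g1v; exact/missingP.
    - by move=> x y /g1b E; apply: g'c E _ _; rewrite eq_sym.
  have [m] : exists m, m \in missing g z :\ b0.
    apply/card_gt0P; move: dz; have := card_near gP zv zu; have := leq_cardsD1 (missing g z) b0.
    by card_lia.
  rewrite in_setD1 => /andP[mb0 mz].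
  have [mv|mv] := boolP (m \in missing g v); first exact: (step g m).
  have mu : m \in missing g u.
    by apply/negPn/negP=> mu; rewrite (missing_uv _ _ gP mu) in mv.
  (* When [m] is missing at [u] instead, a first swap with some [b] missing at [v] makes [b] missing
     at [z]. *)
  have [b] : exists b, b \in missing g v :\ b0.
    apply/card_gt0P; have := card_v _ gP; have := leq_cardsD1 (missing g v) b0.
    by card_lia.
  rewrite in_setD1 => /andP[bb0 bv].
  have [g1 [g1P g1v g1u g1c g1x]] := near_kempe_out evu gP bv mu.
  have bc : b != c by apply: contraNneq cv => <-.
  have mc : m != c by apply: contraPneq mz => ->; apply/negP/seenP; exists w.
  apply: (step g1 b) => //.
  - by rewrite g1x ?mz ?orbT // gz' /= tpermD.
  - move=> x y E; apply: g1c E _ _; rewrite eq_sym //.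
  - apply/missingP=> x; rewrite g1x ?mz ?orbT //.
    case E: (g z x) => [d|] //= -[]; rewrite -[in RHS](tpermR b m) => /perm_inj E'.
    by move/missingP: mz => /(_ x); rewrite E E'.
have finish g b1 x1 x2 : near v u g -> (forall h c1 c2, near v u h -> h w x1 = Some c1 ->
    h w x2 = Some c2 -> c1 \in missing h v -> c2 \in missing h v -> False) ->
    e w x2 -> x2 != u -> x2 != v -> #|nbrs e x2| <= k.+1 -> x1 != x2 ->
    g w x1 = Some b1 -> b1 \in missing g v -> False.
  move=> gP noboth ex2 x2u x2v dx2 x12 gx1 b1v.
  have [c2 gx2] := colour_w g x2 gP ex2 x2v.
  have c21 : c2 != b1.
    apply: contraNneq x12 => E; rewrite E in gx2; have [_ _ gI] := gP; apply/eqP; exact: (gI _ _ _ _ gx1 gx2).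
  have [g' [c' [g'P g'x2 c'v b1v' g'b]]] := bring g x2 c2 b1 gP ex2 x2u x2v dx2 gx2 b1v c21.
  exact: (noboth g' b1 c' g'P (g'b _ _ gx1) g'x2 b1v' c'v).
have at_u g b : near v u g -> g w u = Some b -> b \in missing g v.
  by move=> gP gu; apply: (missing_uv g b gP); apply/seenP; exists w; case: gP => <-.
(* [bring] does not apply to [u], but the colour of [wu] is already missing at [v], being seen at
   [u]. *)
have [z1u|z1u] := eqVneq z1 u.
  have [b1 g1] := colour_w f z1 f0P ewz1 z1v.
  apply: (finish f b1 z1 z2) => //; first by rewrite -z1u eq_sym.
  by apply: (at_u f b1) => //; rewrite -z1u.
have [z2u|z2u] := eqVneq z2 u.
  have [b2 g2] := colour_w f z2 f0P ewz2 z2v.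
  apply: (finish f b2 z2 z1) => //; last by apply: (at_u f b2) => //; rewrite -z2u.
    by move=> h c1 c2 hP h1 h2 c1v c2v; exact: (both h c2 c1).
  by rewrite eq_sym.
have [c1 g1] := colour_w f z1 f0P ewz1 z1v.
(* No edge has to be preserved yet; [b0] is any admissible colour for [bring]. *)
have [b0] : exists b, b \in missing f v :\ c1.
  apply/card_gt0P; have := card_v _ f0P; have := leq_cardsD1 (missing f v) c1.
  by card_lia.
rewrite in_setD1 eq_sym => /andP[c1b0 b0v].
have [g [b1 [gP g1' b1v _ _]]] := bring f z1 c1 b0 f0P ewz1 z1u z1v deg1 g1 b0v c1b0.
exact: (finish g b1 z1 z2).
Qed.

End Uncolourable.

(** Colourings can be searched among finite functions, so colourability is decidable and may be
    proved by contradiction. *)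
Lemma colourable_dnegP e : ~ ~ colourable e -> colourable e.
Proof.
pose ok (F : {ffun V * V -> option C}) := [&& [forall x, forall y, F (x, y) == F (y, x)],
  [forall x, forall y, (F (x, y) : bool) == e x y] &
  [forall x, forall y, forall z, (F (x, y) : bool) && (F (x, y) == F (x, z)) ==> (y == z)]].
have okP : reflect (colourable e) [exists F, ok F].
  apply: (iffP existsP) => -[].
    move=> F /and3P[/forallP Fs /forallP Fe /forallP Fi]; exists (fun x y => F (x, y)); split.
    - by move=> x y; have /forallP/(_ y)/eqP := Fs x.
    - by move=> x y; have /forallP/(_ y)/eqP := Fe x.
    - move=> x y z c E E'; have /forallP/(_ y)/forallP/(_ z) := Fi x.
      by rewrite E E' eqxx => /eqP.
  move=> f [fC fe fI]; exists [ffun p => f p.1 p.2]; apply/and3P; split.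
  - by apply/forallP=> x; apply/forallP=> y; rewrite !ffunE fC.
  - by apply/forallP=> x; apply/forallP=> y; rewrite !ffunE fe.
  - apply/forallP=> x; apply/forallP=> y; apply/forallP=> z; rewrite !ffunE /=.
    case E: (f x y) => [c|] //=; apply/implyP=> /eqP/esym E'; apply/eqP; exact: fI E E'.
by case: okP.
Qed.

(** * Critical graphs along an elimination order *)

Section Ordering.
Variables (k : nat) (h : rel V) (pos : V -> nat).
Hypotheses (k_ge4 : 4 <= k) (C_card : 2 * k <= #|C|.+1).
Hypotheses (pos_inj : injective pos) (h_sym : symmetric h).
Hypothesis h_chordal : forall u x y,
  h u x -> h u y -> x != y -> pos u < pos x -> pos u < pos y -> h x y.
Hypothesis h_later : forall u, #|[set x | h u x && (pos u < pos x)]| <= k.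

Section Critical.
Variable e : rel V.
Hypotheses (e_sym : symmetric e) (e_irr : irreflexive e) (e_unc : ~ colourable e).
Hypothesis e_deg : forall x, #|nbrs e x| <= #|C|.
Hypothesis e_crit : forall u v, e u v -> colourable (del e u v).
Hypothesis e_h : subrel e h.

Let later v : {set V} := [set x | h v x && (pos v < pos x)].
Let first_big v :=
  (k < #|nbrs e v|) && [forall x, h v x && (pos x < pos v) ==> (#|nbrs e x| <= k)].

Let first_earlier v x : first_big v -> h v x -> pos x < pos v -> #|nbrs e x| <= k.
Proof. by case/andP=> _ /forallP/(_ x)/implyP H vx px; apply: H; rewrite vx. Qed.

Let later_or v y : e v y -> y \notin later v -> pos y < pos v.
Proof.
move=> evy; rewrite inE (e_h evy) -leqNgt leq_eqVlt => /predU1P[/pos_inj yv|//].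
by rewrite yv e_irr in evy.
Qed.

(** The fan bounds apply with [K := later v]: the earlier neighbours are small, so every big
    neighbour is later. *)
Let first_struct v u : first_big v -> e v u -> pos u < pos v ->
  [/\ #|C|.+1 = 2 * k, #|nbrs e u| = k, #|later v| = k &
      forall y, y \in later v -> e v y /\ #|nbrs e y| = #|C|].
Proof.
move=> v1 evu puv; have [f fP] := e_crit evu.
have du := first_earlier v1 (e_h evu) puv.
have Kin y : e v y -> k < #|nbrs e y| -> y \in later v.
  move=> evy; rewrite ltnNge; apply: contraR => /(later_or evy).
  exact: first_earlier (e_h evy).
have [-> -> -> _] := fan_image e_sym e_irr e_unc e_deg C_card evu fP du (h_later v) Kin.
by split=> // y; apply: (fan_big e_sym e_irr e_unc e_deg C_card evu fP du (h_later v) Kin).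
Qed.

Let first_earlier_nbr v : first_big v -> exists2 u, e v u & pos u < pos v.
Proof.
case/andP=> dv _; have /subsetPn[u] : ~~ (nbrs e v \subset later v).
  by apply: contraL dv => /subset_leq_card; rewrite -leqNgt => /leq_trans; apply; exact: h_later.
by rewrite inE => evu /(later_or evu); exists u.
Qed.

Lemma critical_contradiction u0 v0 : e u0 v0 -> False.
Proof.
move=> euv0.
have [x0 x0big] : exists x, k < #|nbrs e x|.
  have [f fP] := e_crit euv0; have := near_degree_sum e_sym e_irr e_unc euv0 fP.
  have [|d1] := ltnP k #|nbrs e u0|; first by exists u0.
  have [|d2] := ltnP k #|nbrs e v0|; first by exists v0.
  by move: d1 d2 C_card; clear; lia.
pose bad w := (k < #|nbrs e w|) && ~~ first_big w.
(* If the earliest big vertex is not itself bad, any of its later neighbours is: that neighbour has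
   degree [#|C|] and a big earlier neighbour. *)
have [w0 w0bad] : exists w, bad w.
  case: (@arg_minnP _ x0 (fun x => k < #|nbrs e x|) pos x0big) => v vbig vmin.
  have [v1|vN] := boolP (first_big v); last by exists v; rewrite /bad vbig.
  have [u evu puv] := first_earlier_nbr v1; have [Ck _ Kk Kbig] := first_struct v1 evu puv.
  have /card_gt0P[y yK] : 0 < #|later v| by rewrite Kk; move: k_ge4; clear; lia.
  exists y; have [evy dy] := Kbig y yK; rewrite /bad dy; apply/andP; split.
    by move: Ck k_ge4; clear; lia.
  apply/negP=> y1; move: yK; rewrite inE => /andP[hvy pvy].
  by have := first_earlier y1 _ pvy; rewrite h_sym hvy => /(_ isT); rewrite leqNgt vbig.
case: (@arg_minnP _ w0 bad pos w0bad) => w /andP[wbig wN] wmin.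
have [v [hwv pvw vbig]] : exists v, [/\ h w v, pos v < pos w & k < #|nbrs e v|].
  move: wN; rewrite /first_big wbig /= negb_forall => /existsP[v].
  by rewrite negb_imply -ltnNge => /andP[/andP[? ?] ?]; exists v.
have before x : k < #|nbrs e x| -> pos x < pos w -> first_big x.
  move=> xbig; apply: contraTT => xN; rewrite -leqNgt; apply: wmin; by rewrite /bad xbig.
have v1 := before v vbig pvw.
have [u evu puv] := first_earlier_nbr v1.
have [Ck du Kk Kbig] := first_struct v1 evu puv.
have wK : w \in later v by rewrite inE h_sym hwv.
have [evw dw] := Kbig w wK.
have deg_first x : first_big x -> pos x < pos w -> #|nbrs e x| = k.+1.
  move=> x1 pxw; have [y exy pyx] := first_earlier_nbr x1.
  have [_ dy Kx Kxbig] := first_struct x1 exy pyx.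
  have earlier_deg z : e x z -> z \notin later x -> #|nbrs e z| = k.
    by move=> exz /(later_or exz) pzx; have [] := first_struct x1 exz pzx.
  have xbig : k < #|nbrs e x| by case/andP: x1.
  (* The degree sum makes [t] big. If [t] comes after [x], chordality at [z] joins it to [x].
     Between [z] and [x], it would be a big earlier neighbour of [x]. Before [z], it would be
     [first_big], forcing degree [#|C|] on [z]. *)
  have nbr_later z : e x z -> pos z < pos x -> nbrs e z :\ x \subset later x.
    move=> exz pzx; have [_ dz _ _] := first_struct x1 exz pzx.
    apply/subsetP=> t; rewrite !inE => /andP[tx ezt].
    have [f fP] := e_crit ezt.
    have tbig : k < #|nbrs e t|.
      have := near_degree_sum e_sym e_irr e_unc ezt fP; rewrite dz.
      by move: Ck k_ge4; clear; lia.
    have hzx : h z x by rewrite h_sym e_h.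
    have hzt := e_h ezt.
    have [pxt|ptx|/pos_inj E] := ltngtP (pos x) (pos t); last by rewrite E eqxx in tx.
      by rewrite andbT; apply: (h_chordal hzx hzt) => //; [rewrite eq_sym | exact: ltn_trans pxt].
    have [pzt|ptz|/pos_inj E] := ltngtP (pos z) (pos t).
    - have hxt : h x t by apply: (h_chordal hzx hzt) => //; rewrite eq_sym.
      by have := first_earlier x1 hxt ptx; rewrite leqNgt tbig.
    - have t1 := before t tbig (ltn_trans ptx pxw).
      have [s ets pst] := first_earlier_nbr t1.
      have [_ _ _ Kt] := first_struct t1 ets pst.
      have /Kt[_] : z \in later t by rewrite inE h_sym hzt.
      by rewrite dz; move: Ck k_ge4; clear; lia.
    - by move: ezt; rewrite E e_irr.
  (* Besides [x], both [y] and [z] have [k-1] neighbours within the [k] vertices of [later x], hence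
     a common one; [tight_distance2] through it makes [z] big. *)
  have earlier_uniq z : e x z -> z \notin later x -> z = y.
    move=> exz zK; apply/eqP/negPn/negP=> zy.
    have pzx := later_or exz zK; have [_ dz _ _] := first_struct x1 exz pzx.
    have [f fP] := e_crit exy.
    have [t] : exists t, t \in (nbrs e y :\ x) :&: (nbrs e z :\ x).
      apply/card_gt0P; have := cardsUI (nbrs e y :\ x) (nbrs e z :\ x).
      have := cardsD1 x (nbrs e y); have := cardsD1 x (nbrs e z).
      rewrite !inE [e z x]e_sym [e y x]e_sym exy exz dy dz.
      have : nbrs e y :\ x :|: nbrs e z :\ x \subset later x by rewrite subUset !nbr_later.
      move/subset_leq_card; rewrite Kx add1n; move: k_ge4; clear; lia.
    rewrite !inE => /andP[/andP[tx eyt] /andP[_ ezt]].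
    have etz : e t z by rewrite e_sym.
    have := tight_distance2 e_sym e_irr e_unc e_deg k_ge4 Ck exy dy xbig Kx earlier_deg
      fP eyt tx etz zy.
    by rewrite dz ltnn.
  apply/eqP; rewrite eqn_leq xbig andbT -Kx.
  have : nbrs e x \subset y |: later x.
    apply/subsetP=> z; rewrite inE in_setU1 => exz.
    by have [|/(earlier_uniq z exz)->] := boolP (z \in later x); rewrite ?orbT ?eqxx.
  move/subset_leq_card/leq_trans; apply; rewrite cardsU1 inE.
  by rewrite (e_h exy) [pos x < _]ltnNge (ltnW pyx) andbF.
have [f fP] := e_crit evu; have evw' : e w v by rewrite e_sym.
have wu : w != u by apply: contraTneq wbig => ->; rewrite du ltnn.
(* Of the [2k-1] neighbours of [w] at most [k] are later; removing [v] from the rest leaves at least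
   [k-2 >= 2]. *)
have /card_gt1P[z1 [z2 [z1E z2E]]] : 1 < #|(nbrs e w :\: later w) :\ v|.
  have := cardsD1 v (nbrs e w :\: later w).
  have := cardsID (later w) (nbrs e w); rewrite dw.
  have := subset_leq_card (subsetIr (nbrs e w) (later w)).
  have := h_later w; rewrite -/(later w).
  have -> : (v \in nbrs e w :\: later w) = true.
    by rewrite !inE evw' andbT hwv -leqNgt ltnW.
  by rewrite add1n; move: Ck k_ge4; clear; lia.
have light z : z \in (nbrs e w :\: later w) :\ v ->
    [/\ e w z, z != v & #|nbrs e z| <= k.+1].
  rewrite in_setD1 in_setD => /and3P[zv zK]; rewrite inE => ewz; split=> //.
  have [zbig|/leqW//] := ltnP k #|nbrs e z|.
  have pzw := later_or ewz zK; by rewrite (deg_first z (before z zbig pzw) pzw).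
have [ewz1 z1v d1] := light z1 z1E; have [ewz2 z2v d2] := light z2 z2E.
move/eqP; apply; apply: (light_neighbours e_sym e_irr e_unc e_deg k_ge4 Ck fP evu du
  (deg_first v v1 pvw) evw wu ewz1 ewz2 z1v z2v d1 d2).
Qed.

End Critical.

(** Induction on the number of adjacent pairs makes a counterexample critical, since deleting an
    edge preserves all hypotheses. *)
Lemma subgraph_colourable e : symmetric e -> irreflexive e -> subrel e h ->
  (forall x, #|nbrs e x| <= #|C|) -> colourable e.
Proof.
have [n] := ubnP #|[set p | e p.1 p.2]|; elim: n e => // n IH e en e_sym e_irr e_h e_deg.
apply: colourable_dnegP => e_unc.
have crit u v : e u v -> colourable (del e u v).
  move=> euv; have sub x y : del e u v x y -> e x y by case/andP.
  apply: IH.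
  - apply: leq_trans (_ : #|[set p | e p.1 p.2]| <= n); last by rewrite -ltnS.
    apply: proper_card; apply/properP; split.
      by apply/subsetP=> p; rewrite !inE; exact: sub.
    by exists (u, v); rewrite !inE ?euv //= /del !eqxx andbF.
  - move=> x y; rewrite /del e_sym orbC.
    by rewrite [(y == u) && _]andbC [(y == v) && _]andbC.
  - by move=> x; rewrite /del e_irr.
  - by move=> x y /sub/e_h.
  - move=> x; apply: leq_trans (e_deg x); apply: subset_leq_card; apply/subsetP=> y.
    by rewrite !inE; exact: sub.
have [/existsP[u /existsP[v euv]]|N] := boolP [exists u, exists v, e u v].
  exact: (critical_contradiction e_sym e_irr e_unc e_deg crit e_h euv).
apply: e_unc; exists (fun _ _ => None); split=> // x y; apply/esym/negbTE.
by apply: contra N => exy; apply/existsP; exists x; apply/existsP; exists y.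
Qed.

End Ordering.
End Colouring.

(** * Tree paths and the elimination order *)

Section TreePaths.
Variable T : sgraph.
Hypothesis T_acyclic : forall p : seq T, 2 < size p -> ~ ucycle (@adj T) p.

(** Otherwise the part of [q] up to [t] closes to a cycle through the edge [st]. *)
Lemma tree_path_head (s t : T) q : adj s t -> path (@adj T) s q -> uniq (s :: q) ->
  t \in q -> ohead q = Some t.
Proof.
move=> st sq Uq tq; case/splitPr: tq sq Uq => q1 q2.
rewrite -cat_rcons cat_path => /andP[sq _]; rewrite -cat_cons cat_uniq => /andP[Uq _].
case: q1 sq Uq => // x q1 sq Uq; case: (@T_acyclic (s :: rcons (x :: q1) t)).
  by rewrite /= size_rcons.
by rewrite /ucycle Uq andbT /cycle rcons_path sq last_rcons adj_sym.
Qed.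

(** If the first step [t] of one path is not on [q], then [s :: q] is a path from [t]; by induction
    it equals the rest of the first path, which would then revisit [s]. *)
Lemma tree_path_uniq (s : T) p q : path (@adj T) s p -> uniq (s :: p) ->
  path (@adj T) s q -> uniq (s :: q) -> last s p = last s q -> p = q.
Proof.
elim: p s q => [|t p IH] s q.
  by case: q => // x q _ _ _ /= /andP[/negP sq _] E; case: sq; rewrite E mem_last.
move=> /= /andP[st tp] /andP[sp Utp] sq Uq E.
have [tq|tq] := boolP (t \in q).
  have := tree_path_head st sq Uq tq; case: q sq Uq E {tq} => //= x q /andP[_ xq] /andP[_ Uq] E [xt].
  rewrite xt in xq Uq E *; by rewrite (IH t q).
have := IH t (s :: q) tp Utp; rewrite /= adj_sym st sq => /(_ isT).
rewrite inE negb_or tq andbT eq_sym; have [E'|_] := eqVneq s t.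
  by rewrite E' inE eqxx in sp.
move=> /(_ Uq E) E'; by rewrite E' !inE eqxx orbT in sp.
Qed.
End TreePaths.

(** Root the tree and eliminate vertices whose topmost bag is deepest first. All later neighbours of
    [u] then lie in the topmost bag of [u], which gives both the clique and the bound [k]. *)
Lemma elimination_order (G : sgraph) (k : nat) : has_tree_decomposition G k ->
  exists (h : rel G) (pos : G -> nat),
    [/\ injective pos, symmetric h, subrel (@adj G) h,
        forall u x y, h u x -> h u y -> x != y -> pos u < pos x -> pos u < pos y -> h x y
      & forall u, #|[set x | h u x && (pos u < pos x)]| <= k].
Proof.
move=> [T [B [[[T0 Tconn Tacyc] Bv Be Bp] Bk]]].
have [r _] : exists r : T, r \in T by apply/card_gt0P.
have ex_path s : exists p, [&& path (@adj T) s p, uniq (s :: p) & last s p == r].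
  have /connectP[p sp ->] := Tconn s r; case/shortenP: sp => q sq Uq _.
  by exists q; rewrite sq Uq eqxx.
pose rp s := xchoose (ex_path s).
have rpP s : [/\ path (@adj T) s (rp s), uniq (s :: rp s) & last s (rp s) = r].
  by have /and3P[? ? /eqP] := xchooseP (ex_path s).
have rp_uniq s q : path (@adj T) s q -> uniq (s :: q) -> last s q = r -> q = rp s.
  move=> sq Uq E; have [sp Up E'] := rpP s.
  by apply: tree_path_uniq sq Uq sp Up _; rewrite // E.
pose depth s := size (rp s).
have depth_lt s : depth s < #|T|.
  have [_ /card_uniqP E _] := rpP s; by rewrite -[_.+1]/(size (s :: rp s)) -E max_card.
have ex_bag v : exists t, v \in B t by exact: Bv.
(* The node of the subtree of v that is closest to the root r. *)
pose top v := [arg min_(s < xchoose (ex_bag v) | v \in B s) depth s].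
have topP v : v \in B (top v) /\ forall s, v \in B s -> depth (top v) <= depth s.
  by rewrite /top; case: arg_minnP => [|s sv smin]; [exact: xchooseP (ex_bag v) | split].
have top_path v t : v \in B t -> exists q,
    [/\ last t q = top v, rp t = q ++ rp (top v) & forall s, s \in t :: q -> v \in B s].
  move=> vt; have [vm mmin] := topP v; set m := top v in vm mmin *.
  have /connectP[q0 tq0 mq0] := Tconn t m; case/shortenP: tq0 mq0 => q tq Uq _ mq.
  have vq s : s \in t :: q -> v \in B s by apply: (Bp v t m q).
  have [mp Up Ep] := rpP m.
  exists q; split=> //; apply/esym/rp_uniq.
  - by rewrite cat_path tq -mq.
  - rewrite -cat_cons cat_uniq Uq; move: (Up); rewrite cons_uniq => /andP[_ ->]; rewrite andbT.
    (* A node on both pieces would contain [v] and be nearer to the root than [top v]. *)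
    apply/hasPn=> x xp; apply/negP=> xq; have := mmin x (vq x xq).
    have [p1 [p2 E]] : exists p1 p2, rp m = p1 ++ x :: p2.
      by case/splitPr: xp => p1 p2; exists p1, p2.
    rewrite /depth E size_cat /=; move: mp Up Ep; rewrite E cat_path last_cat.
    move=> /andP[_ /andP[_ xp2]]; rewrite -cat_cons cat_uniq => /and3P[_ _ Up2] Ep2.
    by rewrite -(rp_uniq x p2 xp2 Up2 Ep2); lia.
  - by rewrite last_cat -mq.
pose h : rel G := fun x y => (x != y) && [exists t, (x \in B t) && (y \in B t)].
(* Depth decides and the rank breaks ties: ranks are below [#|G|], so they never outweigh a
   difference in depth. *)
pose pos u := (#|T| - depth (top u)) * #|G| + enum_rank u.
have pos_depth u x : pos u < pos x -> depth (top x) <= depth (top u).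
  rewrite /pos leqNgt => lt; apply/negP => D; move: lt; apply/negP; rewrite -leqNgt.
  have := ltn_ord (enum_rank x); have := depth_lt (top x).
  move: (depth _) (depth _) D (enum_rank _ : nat) (enum_rank _ : nat) => a b D i j.
  move: #|T| #|G| => n m bn jm.
  have H : (n - b).+1 * m <= (n - a) * m by rewrite leq_mul2r; lia.
  by rewrite mulSn in H; lia.
(* From a common bag [t], both topmost nodes lie on the path to the root. The deeper one, [top u],
   is met on the way to [top x], where every bag contains [x]. *)
have bag_top u x : h u x -> pos u < pos x -> x \in B (top u).
  case/andP=> _ /existsP[t /andP[ut xt]] /pos_depth le.
  have [qu [lu Eu _]] := top_path u t ut; have [qx [lx Ex Bx]] := top_path x t xt.
  apply: Bx; rewrite -lu.
  have le' : size qu <= size qx.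
    by rewrite -(leq_add2r (size (rp (top u)))) -size_cat -Eu Ex size_cat leq_add2l.
  have -> : qu = take (size qu) qx.
    by rewrite -(takel_cat (rp (top x))) // -Ex Eu take_size_cat.
  have := mem_last t (take (size qu) qx); rewrite !inE => /orP[->//|/mem_take->].
  by rewrite orbT.
have h_sym : symmetric h.
  by move=> x y; rewrite /h eq_sym; congr (_ && _); apply: eq_existsb => t; rewrite andbC.
exists h, pos; split => //.
- move=> u x /(congr1 (modn^~ #|G|)); rewrite /pos !modnMDl !modn_small // => E.
  by apply: enum_rank_inj; apply: val_inj.
- move=> x y xy; apply/andP; split; first by apply: contraTneq xy => ->; rewrite adj_irrefl.
  by apply/existsP; exact: Be.
- move=> u x y ux uy xy px py; rewrite /h xy; apply/existsP; exists (top u).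
  by rewrite !bag_top.
- move=> u; rewrite -ltnS; apply: leq_trans (Bk (top u)); have [utop _] := topP u.
  rewrite (cardsD1 u (B _)) utop ltnS; apply/subset_leq_card/subsetP => x.
  rewrite !inE => /andP[ux px]; rewrite bag_top // andbT eq_sym.
  by case/andP: ux.
Qed.

(** * Transfer to colourings of the edge set *)

Lemma edge_colourable_of_colourable (G : sgraph) n :
  colourable 'I_n.+1 (@adj G) -> edge_colourable G n.+1.
Proof.
case=> f [fC fe fI].
pose col (F : edge G) := odflt ord0 [pick a | [exists x, exists y,
  (val F == [set x; y]) && (f x y == Some a)]].
have colP (F : edge G) x : x \in val F -> exists2 y, val F = [set x; y] & f x y = Some (col F).
  rewrite /col; case: pickP => [a /existsP[s /existsP[t /andP[/eqP-> /eqP E]]] | N] /=.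
    case/set2P=> ->; first by exists t.
    by exists s; rewrite 1?setUC // fC.
  have /imset2P[s t _ ast E] := valP F.
  move: (fe s t); rewrite [adj s t]ast; case Ea: (f s t) => [a|] // _.
  by have /existsP[] := N a; exists s; apply/existsP; exists t; rewrite E Ea !eqxx.
apply/existsP; exists (finfun col); apply/forallP=> F; apply/forallP=> F'.
apply/implyP=> /andP[FF' /pred0Pn[x /andP[/= xF xF']]]; rewrite !ffunE.
apply: contra FF' => /eqP cFF'.
have [y Fy fy] := colP F x xF; have [z Fz fz] := colP F' x xF'.
by rewrite -cFF' in fz; apply/eqP/val_inj; rewrite Fy Fz (fI _ _ _ _ fy fz).
Qed.

Lemma degree_le_colours (G : sgraph) n (x : G) : edge_colourable G n -> degree x <= n.
Proof.
case/existsP=> c /forallP cP.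
have mem_edges y : adj x y -> [set x; y] \in edges G.
  by move=> xy; apply/imset2P; exists x y.
pose colour y : option 'I_n := if insub [set x; y] is Some F then Some (c F) else None.
have colour_adj y (xy : adj x y) : colour y = Some (c (Sub [set x; y] (mem_edges y xy))).
  rewrite /colour; case: insubP => [F _ EF|]; last by rewrite mem_edges.
  by congr (Some (c _)); apply: val_inj.
rewrite -[n]card_ord /degree.
rewrite -(@card_in_imset _ _ colour) => [|y z]; last first.
  rewrite !inE => xy xz; rewrite (colour_adj y xy) (colour_adj z xz) => -[E].
  apply/eqP; apply: contraT => yz.
  have /forallP/(_ (Sub [set x; z] (mem_edges z xz)))/implyP := cP (Sub [set x; y] (mem_edges y xy)).
  rewrite E eqxx => H; apply: H; apply/andP; split.
    apply: contra yz => /eqP/(congr1 val); rewrite /= => /setP/(_ y).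
    rewrite !inE eqxx orbT => /esym/orP[/eqP E'|->//].
    by have := xy; rewrite E' adj_irrefl.
  by apply/pred0Pn; exists x; rewrite /= !inE eqxx.
have si : injective (@Some 'I_n) by move=> ? ? [].
rewrite -(card_imset _ si); apply/subset_leq_card/subsetP=> _ /imsetP[y xy ->].
by rewrite inE in xy; rewrite (colour_adj y xy) imset_f.
Qed.

Theorem proposition1 (k : nat) (hk : 4 <= k) (G : sgraph)
    (htw : treewidth_is G k) (hD : 2 * k - 1 <= max_degree G) :
  chromatic_index G = max_degree G.
Proof.
have [h [pos [pos_inj h_sym adj_h h_chordal h_later]]] := elimination_order htw.1.
rewrite /chromatic_index; case: ex_minnP => m Gm mmin; apply/eqP; rewrite eqn_leq.
apply/andP; split; last by apply/bigmax_leqP=> x _; exact: degree_le_colours.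
(* Maximum degree 0 is excluded by [hD], so the colour type is nonempty. *)
apply: mmin; case E: (max_degree G) hD => [|n] hD; first by lia.
apply: edge_colourable_of_colourable.
apply: (subgraph_colourable (k := k) hk _ pos_inj h_sym h_chordal h_later) => //.
- by rewrite card_ord; lia.
- exact: adj_sym.
- exact: adj_irrefl.
- by move=> x; rewrite card_ord -E; exact: (leq_bigmax x).
Qed.
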